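(* The embedding in $\mathbb{P}^{13}$ of the BS-EF 3-fold $W_{BS}^{13}$ of genus $13$ is an F-EF 3-fold $W_F^{13}\subset\mathbb{P}^{13}$ of genus $13$.
   Context: We work over $\mathbb{C}$. $W_{BS}^{13}$: let $X=\mathbb{P}^1\times\mathbb{P}^1\times\mathbb{P}^1$, with coordinates $[x_0:x_1]\times[y_0:y_1]\times[z_0:z_1]$, and let $\sigma:X\to X$ be the involution $[x_0:x_1]\times[y_0:y_1]\times[z_0:z_1]\mapsto[x_0:-x_1]\times[y_0:-y_1]\times[z_0:-z_1]$. The BS-EF 3-fold of genus $13$ is $W_{BS}^{13}=X/\sigma$, embedded in $\mathbb{P}^{13}$ by the quotient map $X\to\mathbb{P}^{13}$ whose coordinates are the fourteen $\sigma$-invariant monomials of multidegree $(2,2,2)$. $W_F^{13}$: the F-EF 3-fold of genus $13$ is the (closure of the) image in $\mathbb{P}^{13}$ of the rational map $\mathbb{P}^3\dashrightarrow\mathbb{P}^{13}$ defined by the linear system of the sextic surfaces of $\mathbb{P}^3$ having double points along the six edges of a tetrahedron. It is determined up to projective transformations of $\mathbb{P}^{13}$. *)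

(* Defs.v *)
From HB Require Import structures.
From mathcomp Require Import all_boot all_order all_algebra.
From mathcomp Require Export mpoly complex.
From mathcomp Require Export classical_sets reals.

Set Implicit Arguments.
Unset Strict Implicit.
Unset Printing Implicit Defensive.

Import GRing.Theory Num.Theory.
Local Open Scope ring_scope.
Local Open Scope classical_set_scope.

(* P^n(K) is the type of lines through the origin of K^(n+1), so that equality
   of points is Leibniz equality. Varieties are identified with their sets of
   K-points (K will be the field of complex numbers). *)
Definition proj (K : fieldType) (n : nat) : Type :=
  {L : {vspace 'rV[K]_n.+1} | \dim L == 1%N}.

Definition hcoord (K : fieldType) (n : nat) (p : proj K n) (v : 'rV[K]_n.+1) :=
  (v != 0) && (v \in val p).

Definition zero_locus (K : fieldType) (n : nat) (S : set {mpoly K[n.+1]}) :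
    set (proj K n) :=
  [set p | forall F v, S F -> hcoord p v -> F.@[v 0] = 0].

Definition zariski_closed (K : fieldType) (n : nat) (Z : set (proj K n)) :=
  exists S : set {mpoly K[n.+1]},
    (forall F, S F -> exists d : nat, F \is d.-homog) /\ Z = zero_locus S.

Definition zariski_closure (K : fieldType) (n : nat) (A : set (proj K n)) :
    set (proj K n) :=
  smallest (@zariski_closed K n) A.

(* In homogeneous coordinates and in characteristic 0: the hypersurface F = 0
   has multiplicity at least k at p iff all partial derivatives of F of order
   less than k vanish at p. *)
Definition mult_ge (K : fieldType) (n k : nat) (F : {mpoly K[n.+1]})
    (p : proj K n) :=
  forall (v : 'rV[K]_n.+1) (m : 'X_{1..n.+1}),
    hcoord p v -> (mdeg m < k)%N -> (F^`M[m]).@[v 0] = 0.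

(* The rows of T are the vertices of the tetrahedron, which are not coplanar
   when T is invertible. *)
Definition edge (K : fieldType) (T : 'M[K]_4) (i j : 'I_4) : set (proj K 3) :=
  [set p | (val p <= <[row i T]> + <[row j T]>)%VS].

Definition double_edge_sextics (K : fieldType) (T : 'M[K]_4) :
    set {mpoly K[4]} :=
  [set F | F \is 6.-homog /\
     forall (i j : 'I_4) (p : proj K 3),
       (i < j)%N -> edge T i j p -> mult_ge 2 F p].

Definition basis_of_system (K : fieldType) (n N : nat)
    (L : set {mpoly K[n]}) (f : 'I_N -> {mpoly K[n]}) :=
  (forall k, L (f k)) /\
  (forall F, L F -> exists! c : 'rV[K]_N, F = \sum_(k < N) c 0 k *: f k).

(* The rational map p |-> [f_0(p) : ... : f_N(p)] is undefined exactly where all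
   the f_k vanish: there \row_k _ is 0, which is never an hcoord. *)
Definition ratmap_image (K : fieldType) (n N : nat)
    (f : 'I_N.+1 -> {mpoly K[n.+1]}) : set (proj K N) :=
  [set q | exists (p : proj K n) (v : 'rV[K]_n.+1),
     hcoord p v /\ hcoord q (\row_k (f k).@[v 0])].

(* Changing the basis f amounts to a projective transformation of P^13, so this
   class of subsets is stable under projective transformations. *)
Definition is_FEF13 (K : fieldType) (W : set (proj K 13)) :=
  exists (T : 'M[K]_4) (f : 'I_14 -> {mpoly K[4]}),
    [/\ T \in unitmx,
        basis_of_system (double_edge_sextics T) f
      & W = zariski_closure (ratmap_image f)].

(* A point of P^1 x P^1 x P^1 has homogeneous coordinates the rows of a 3 x 2
   matrix x; a monomial in these six coordinates has a 3 x 2 exponent matrix. *)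
Definition coord_monomial (K : fieldType) (m : 'M[nat]_(3, 2))
    (x : 'M[K]_(3, 2)) : K :=
  \prod_(i < 3) \prod_(j < 2) x i j ^+ m i j.

Definition multidegree222 (m : 'M[nat]_(3, 2)) :=
  forall i : 'I_3, (\sum_(j < 2) m i j = 2)%N.

Definition sigma (K : fieldType) (x : 'M[K]_(3, 2)) : 'M[K]_(3, 2) :=
  \matrix_(i, j) (if j == 0 then x i j else - x i j).

Definition sigma_invariant (K : fieldType) (m : 'M[nat]_(3, 2)) :=
  forall x : 'M[K]_(3, 2), coord_monomial m (sigma x) = coord_monomial m x.

Definition enum_invariants (K : fieldType) (e : 'I_14 -> 'M[nat]_(3, 2)) :=
  injective e /\
  forall m, (multidegree222 m /\ sigma_invariant K m) <-> exists k, e k = m.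

(* The quotient X / sigma embedded in P^13 is the image of the quotient map. *)
Definition W_BS13 (K : fieldType) (e : 'I_14 -> 'M[nat]_(3, 2)) :
    set (proj K 13) :=
  [set q | exists (p : 'I_3 -> proj K 1) (x : 'M[K]_(3, 2)),
     (forall i, hcoord (p i) (row i x)) /\
     hcoord q (\row_k coord_monomial (e k) x)].

Arguments W_BS13 K e : clear implicits.

Definition even_exponents : seq (seq nat) :=
  [seq s <- [seq a :: s | a <- iota 0 3,
                          s <- [seq [:: b; c] | b <- iota 0 3, c <- iota 0 3]]
  | ~~ odd (sumn s)].

Lemma enum_invariants_exists (K : numFieldType) :
  exists e, enum_invariants K e.
Proof.
pose mx (s : seq nat) : 'M[nat]_(3, 2) :=
  \matrix_(i, j) (if j == 0 then (2 - nth 0 s i)%N else nth 0%N s i).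
pose tr (m : 'M[nat]_(3, 2)) := [seq m i 1 | i : 'I_3].
have tr_mx s : s \in even_exponents -> tr (mx s) = s.
  rewrite /tr.
  have -> : [seq mx s i 1 | i : 'I_3] = [seq nth 0%N s i | i <- iota 0 3].
    by rewrite -val_enum_ord -map_comp; apply: eq_map => i /=; rewrite /= mxE.
  have /allP A : all (fun s => [seq nth 0%N s i | i <- iota 0 3] == s)
      even_exponents by [].
  by move=> /A/eqP.
have mx_tr m : multidegree222 m -> mx (tr m) = m.
  move=> md; apply/matrixP => i j; rewrite mxE.
  rewrite (nth_map ord0) ?size_enum_ord // nth_ord_enum.
  have := md i; rewrite !big_ord_recl big_ord0 addn0 => H.
  have E1 : 1 = lift ord0 ord0 :> 'I_2 by apply/val_inj.
  case: (unliftP ord0 j) => [j' ->|->] /=; first by rewrite ord1 E1.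
  by rewrite E1 -[X in (X - _)%N]H addnK.
have sgn m (x : 'M[K]_(3, 2)) :
    coord_monomial m (sigma x) = (-1) ^+ sumn (tr m) * coord_monomial m x.
  have -> : sumn (tr m) = (\sum_(i < 3) m i 1%R)%N.
    by rewrite sumnE big_map big_enum.
  rewrite /coord_monomial -prodrXr -big_split; apply: eq_bigr => i _ /=.
  rewrite !big_ord_recl !big_ord0 !mxE /= !mulr1.
  have <- : 1 = lift ord0 ord0 :> 'I_2 by apply/val_inj.
  by rewrite (exprNn (x i 1)) mulrCA.
have inv_even m : sigma_invariant K m <-> ~~ odd (sumn (tr m)).
  split=> [/(_ (const_mx 1)) | ev x]; last first.
    by rewrite sgn -signr_odd (negbTE ev) mul1r.
  rewrite sgn; have -> : coord_monomial m (const_mx 1 : 'M[K]_(3, 2)) = 1.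
    by apply: big1 => i _; apply: big1 => j _; rewrite mxE expr1n.
  rewrite mulr1 -signr_odd; case: odd => //= /eqP.
  by rewrite expr1 -subr_eq0 -opprD oppr_eq0 (pnatr_eq0 K 2).
have md_mx s : s \in even_exponents -> multidegree222 (mx s).
  move=> sE i; rewrite !big_ord_recl big_ord0 !mxE /= addn0 subnK //.
  have : all (fun s => all (fun i => nth 0 s i <= 2) (iota 0 3))%N even_exponents.
    by [].
  by move=> /allP/(_ s sE)/allP; apply; rewrite mem_iota ltn_ord.
have ev_in m : multidegree222 m -> ~~ odd (sumn (tr m)) ->
    tr m \in even_exponents.
  move=> md ev; rewrite mem_filter ev andTb.
  have le2 i : m i 1 \in iota 0 3.
    rewrite mem_iota /= add0n ltnS -[X in (_ <= X)%N](md i) (bigD1 1%R) //=.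
    exact: leq_addr.
  have -> : tr m = [:: m ord0 1; m (lift ord0 ord0) 1;
                       m (lift ord0 (lift ord0 ord0)) 1].
    by rewrite /tr /image_mem !enum_ordSl /= (size0nil (size_enum_ord 0)).
  by apply: allpairs_f => //; apply: allpairs_f.
have sz : size even_exponents = 14%N by [].
have in_e (k : 'I_14) : nth [::] even_exponents k \in even_exponents.
  by rewrite mem_nth ?sz.
exists (fun k => mx (nth [::] even_exponents k)); split=> [k l /(congr1 tr)|m].
  rewrite !tr_mx // => /eqP; rewrite nth_uniq ?sz //.
  by move/eqP/val_inj.
split=> [[md /inv_even ev]|[k <-]]; last first.
  split; first exact: md_mx.
  apply/inv_even; rewrite tr_mx //.
  by have := in_e k; rewrite mem_filter => /andP[].
have mE := ev_in m md ev.
have lt14 : (index (tr m) even_exponents < 14)%N by rewrite -sz index_mem.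
by exists (Ordinal lt14); rewrite /= nth_index // mx_tr.
Qed.

(* Main.v *)
Require Import Defs.
From mathcomp Require Import all_boot all_order all_algebra.
From mathcomp Require Import zify ring.

(** Both threefolds are images of monomial maps, and the two families of
    fourteen monomials become proportional under an explicit rational map from
    the cube of P^1 to P^3.

    Take the coordinate tetrahedron. A sextic F is double along the edge where
    only the coordinates i and j may be nonzero iff every monomial of F has
    total degree at least 2 in the two other coordinates
    ([mult_ge_edge1P]); so the linear system has a basis of monomials. Their
    exponents b are matched with the exponents m of the invariant monomials on
    the cube by a linear map: place the four coordinates s_t of P^3 at the
    vertices 111, 100, 010, 001 of the unit cube, which form an inscribed
    tetrahedron, and put s_t = the product over the factors i of x_(i, j) with j
    the i-th coordinate of the vertex t. An s-monomial of exponent b pulls back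
    to an x-monomial whose exponent at (i, j) is the sum of the b_t over the face
    number (i, j) of the cube, and the relation [sum_sextic_exponent] says that
    this is m + 2. Each of the six faces contains exactly one edge of the
    tetrahedron, so the six inequalities on b say that m is nonnegative
    ([sextic_exponent_surj]). Hence the sextics,
    pulled back, are the invariant monomials times the square of the product of
    all six x-coordinates ([sextic_monomial_cube]).

    It remains to compare closures. The quotient of the cube is cut out by
    the binomial quadrics expressing that two products of invariant monomials
    coincide ([W_BS13_quadrics]). It is therefore closed, and it contains the
    image of P^3, because the matching of exponents is linear and so preserves
    these relations ([ratmap_sub_W_BS13]). Conversely a form vanishing on the
    image of P^3 vanishes at the points of the quotient with all six coordinates
    nonzero, hence on all of it ([W_BS13_sub_closed]).

    That the quadrics suffice is seen near a vertex of the cube: some monomial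
    whose exponents are all 0 or 2 is nonzero at the point, and dividing by it
    the monomials of degree 2 in the affine coordinates t_i form a symmetric
    matrix of rank at most one, hence of the form (t_i t_j) over a field with
    square roots; the other monomials have even degree in t and are products of
    these. *)

Set Implicit Arguments.
Unset Strict Implicit.
Unset Printing Implicit Defensive.

Import GRing.Theory Num.Theory.
Local Open Scope ring_scope.
Local Open Scope classical_set_scope.

(** * Homogeneous coordinates *)

Lemma hcoordZ (K : fieldType) n (p : proj K n) v a :
  a != 0 -> hcoord p v -> hcoord p (a *: v).
Proof.
by move=> a0 /andP[v0 vp]; rewrite /hcoord scaler_eq0 negb_or a0 v0 memvZ.
Qed.

Lemma hcoord_scale (K : fieldType) n (p : proj K n) v w :
  hcoord p v -> hcoord p w -> exists2 a, a != 0 & w = a *: v.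
Proof.
move=> /andP[v0 vp] /andP[w0 wp].
have /eqP Ev : (<[v]> == val p)%VS.
  by rewrite eqEdim dim_vline v0 (eqP (valP p)) -memvE vp.
move: wp; rewrite -Ev => /vlineP[a Ew]; exists a => //.
by apply: contraNneq w0 => a0; rewrite Ew a0 scale0r.
Qed.

Lemma hcoord_exists (K : fieldType) n (v : 'rV[K]_n.+1) :
  v != 0 -> exists p : proj K n, hcoord p v.
Proof.
move=> v0; have L : \dim <[v]> == 1%N by rewrite dim_vline v0.
by exists (exist _ <[v]>%VS L); rewrite /hcoord v0 memv_line.
Qed.

Lemma dhomog_mevalZ (K : comNzRingType) n d (F : {mpoly K[n]}) a (v : 'I_n -> K) :
  F \is d.-homog -> F.@[fun i => a * v i] = a ^+ d * F.@[v].
Proof.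
move=> /dhomogP hF; rewrite !mevalE mulr_sumr !big_seq; apply: eq_bigr => m mF.
under eq_bigr do rewrite exprMn.
by rewrite big_split /= prodrXr -mdegE [mdeg m](hF m mF) mulrCA.
Qed.

(** [zero_locus] tests every representative of the point; homogeneity makes one
    enough. *)
Lemma mem_zero_locus (K : fieldType) n (S : set {mpoly K[n.+1]}) (p : proj K n) v :
  (forall F, S F -> exists d : nat, F \is d.-homog) -> hcoord p v ->
  (forall F, S F -> F.@[v 0] = 0) -> zero_locus S p.
Proof.
move=> hS pv Sv F w SF pw; have [d hF] := hS F SF.
have [a _ ->] := hcoord_scale pv pw.
rewrite (meval_eq _ (v2 := fun i => a * v 0 i)); last by move=> i; rewrite mxE.
by rewrite (dhomog_mevalZ _ _ hF) Sv // mulr0.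
Qed.

(** * Exponents of the invariant monomials *)

Lemma odd_sum (I : finType) (F : I -> nat) :
  odd (\sum_i F i) = \big[addb/false]_i odd (F i).
Proof. exact: (big_morph odd oddD (erefl _)). Qed.

Lemma big_ord2 (R : Type) (idx : R) (op : Monoid.law idx) (F : 'I_2 -> R) :
  \big[op/idx]_(i < 2) F i = op (F 0) (F 1).
Proof.
rewrite !big_ord_recl big_ord0 Monoid.mulm1; congr (op _ (F _)).
exact: val_inj.
Qed.

(** The exponents of the invariant monomials, described independently of the
    field. The sum of the second column is the number of sign changes caused by
    the involution. *)
Definition even_exponent (m : 'M[nat]_(3, 2)) :=
  (forall i, m i 0%R + m i 1%R = 2)%N /\ ~~ odd (\sum_i m i 1%R).

Lemma coord_monomial_sigma (K : fieldType) (m : 'M[nat]_(3, 2)) (x : 'M[K]_(3, 2)) :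
  coord_monomial m (sigma x) = (-1) ^+ (\sum_i m i 1%R) * coord_monomial m x.
Proof.
rewrite /coord_monomial -prodrXr -big_split; apply: eq_bigr => i _ /=.
by rewrite !big_ord2 !mxE /= (exprNn (x i 1)) mulrCA.
Qed.

Lemma invariant_exponentP (K : numFieldType) (m : 'M[nat]_(3, 2)) :
  multidegree222 m /\ sigma_invariant K m <-> even_exponent m.
Proof.
have E : multidegree222 m <-> forall i, (m i 0%R + m i 1%R = 2)%N.
  by split=> H i; have := H i; rewrite big_ord2.
rewrite E; split=> -[dm im]; split=> //; last first.
  by move=> x; rewrite coord_monomial_sigma -signr_odd (negbTE im) mul1r.
(* At the point with all coordinates 1 the monomial is 1, which isolates the
   sign. *)
have := im (const_mx 1); rewrite coord_monomial_sigma.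
have -> : coord_monomial m (const_mx 1 : 'M[K]_(3, 2)) = 1.
  by apply: big1 => i _; apply: big1 => j _; rewrite mxE expr1n.
rewrite mulr1 -signr_odd; case: odd => //= /eqP.
by rewrite expr1 -subr_eq0 -opprD oppr_eq0 (pnatr_eq0 K 2).
Qed.

(** The binomial relations: the products of the monomials on the two sides
    coincide. *)
Definition balanced (m m' n n' : 'M[nat]_(3, 2)) :=
  forall i j, (m i j + m' i j = n i j + n' i j)%N.

Lemma coord_monomial_balanced (K : fieldType) m m' n n' (x : 'M[K]_(3, 2)) :
  balanced m m' n n' ->
  coord_monomial m x * coord_monomial m' x
    = coord_monomial n x * coord_monomial n' x.
Proof.
move=> bal; rewrite /coord_monomial -!big_split; apply: eq_bigr => i _ /=.
by rewrite -!big_split; apply: eq_bigr => j _ /=; rewrite -!exprD bal.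
Qed.

(** * Points with prescribed monomials *)

(** In each factor [c i] is the coordinate set to 1, and [a i] is the exponent of
    the other one. The truncated subtraction is exact for [a i] at most 2. *)
Definition chart_exponent (c : 'I_3 -> 'I_2) (a : 'X_{1..3}) : 'M[nat]_(3, 2) :=
  \matrix_(i, j) if j == c i then (2 - a i)%N else a i.

Definition chart_point (K : fieldType) (c : 'I_3 -> 'I_2) (t : 'I_3 -> K) :
    'M[K]_(3, 2) :=
  \matrix_(i, j) if j == c i then 1 else t i.

Lemma ord2P (P : 'I_2 -> Prop) : P 0 -> P 1 -> forall j, P j.
Proof.
move=> P0 P1 [[|[|//]] lt_j].
  by rewrite (_ : Ordinal _ = 0) //; apply: val_inj.
by rewrite (_ : Ordinal _ = 1) //; apply: val_inj.
Qed.

Lemma coord_monomial_chart (K : fieldType) c (t : 'I_3 -> K) a :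
  coord_monomial (chart_exponent c a) (chart_point c t) = \prod_i t i ^+ a i.
Proof.
apply: eq_bigr => i _; rewrite big_ord2 !mxE.
by elim/ord2P: (c i) => /=; rewrite expr1n ?mulr1 ?mul1r.
Qed.

Lemma even_chart_exponent c (a : 'X_{1..3}) :
  (forall i, a i <= 2)%N -> ~~ odd (mdeg a) -> even_exponent (chart_exponent c a).
Proof.
move=> a2 ev; split=> [i|].
  by rewrite !mxE; have := a2 i; elim/ord2P: (c i) => /= ?; lia.
move: ev; rewrite mdegE !odd_sum; congr (~~ _); apply: eq_bigr => i _.
by rewrite mxE; case: ifP => // _; rewrite oddB.
Qed.

Lemma chart_exponent_exists c m : even_exponent m ->
  exists a : 'X_{1..3},
    [/\ (forall i, a i <= 2)%N, ~~ odd (mdeg a) & m = chart_exponent c a].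
Proof.
move=> [dm ev]; exists [multinom (2 - m i (c i))%N | i < 3]; split=> [i||].
- by rewrite mnmE leq_subr.
- move: ev; rewrite mdegE !odd_sum; congr (~~ _); apply: eq_bigr => i _.
  by rewrite mnmE; have := dm i; elim/ord2P: (c i) => ?; lia.
- apply/matrixP => i j; rewrite mxE mnmE; have := dm i.
  by elim/ord2P: (c i); elim/ord2P: j => /= ?; lia.
Qed.

(** If the diagonal vanishes then so does the matrix, as A_ij^2 = A_ii A_jj. If
    A_00 is a nonzero diagonal entry, the row A_0j divided by a square root of
    A_00 is the required vector. *)
Lemma rank_one_symmetric (K : numClosedFieldType) n (A : 'I_n -> 'I_n -> K) :
  (forall i j k l, A i j * A k l = A i k * A j l) ->
  exists t, forall i j, A i j = t i * t j.
Proof.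
move=> A2; have [/forallP A0|] := boolP [forall i, A i i == 0].
  exists (fun=> 0) => i j; apply/eqP; rewrite mul0r -sqrf_eq0 expr2.
  by rewrite A2 (eqP (A0 i)) mul0r.
rewrite negb_forall => /existsP[i0 Ai0]; set r := sqrtC (A i0 i0).
have r0 : r != 0 by rewrite sqrtC_eq0.
exists (fun j => A i0 j / r) => i j; apply: (mulfI Ai0).
rewrite A2 mulrACA -invfM -expr2 sqrtCK; field; exact: Ai0.
Qed.

(** An even monomial is a product of quadratic ones: peel off two variables at a
    time. [D] is the range of exponents on which the values [U] are known to be
    multiplicative. *)
Lemma monomial_of_quadrics (K : fieldType) n (t : 'I_n -> K)
    (U : 'X_{1..n} -> K) (D : pred 'X_{1..n}) :
  D 0%MM -> U 0%MM != 0 ->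
  (forall a i j, D (a + U_(i) + U_(j))%MM ->
     D a /\ U (a + U_(i) + U_(j))%MM * U 0%MM = U a * U (U_(i) + U_(j))%MM) ->
  (forall i j, U (U_(i) + U_(j))%MM = U 0%MM * (t i * t j)) ->
  forall a, D a -> ~~ odd (mdeg a) -> U a = U 0%MM * \prod_i t i ^+ a i.
Proof.
move=> D0 U0 step Ut a.
have pick1 (b : 'X_{1..n}) : mdeg b != 0%N -> exists b' i, b = (b' + U_(i))%MM.
  rewrite mdegE sum_nat_eq0 negb_forall => /existsP[i bi].
  exists (b - U_(i))%MM, i; apply/mnmP => j; rewrite mnmDE mnmBE mnm1E subnK //.
  by case: eqP => // <-; rewrite lt0n.
have [d] := ubnP (mdeg a); elim: d => // d IH in a *; rewrite ltnS => ad Da ev.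
have [/eqP|a0] := eqVneq (mdeg a) 0%N.
  rewrite mdeg_eq0 => /eqP ->; rewrite big1 ?mulr1 // => i _.
  by rewrite mnm0E expr0.
have [b [j Eb]] := pick1 a a0; have dab : mdeg a = (mdeg b).+1.
  by rewrite Eb mdegD mdeg1 addn1.
have [|a' [i Ea']] := pick1 b; first by apply: contraNneq ev => b0; rewrite dab b0.
have dba : mdeg b = (mdeg a').+1 by rewrite Ea' mdegD mdeg1 addn1.
move: Da; rewrite Eb Ea' => /step [Da' Ua]; apply: (mulIf U0); rewrite Ua Ut IH //.
- under [in RHS]eq_bigr do rewrite !mnmDE !exprD.
  rewrite !big_split /=.
  have P1 k : \prod_l t l ^+ U_(k)%MM l = t k.
    rewrite (bigD1 k) //= mnm1E eqxx expr1 big1 ?mulr1 // => l lk.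
    by rewrite mnm1E eq_sym (negbTE lk) expr0.
  by rewrite !P1; ring.
- by apply: leq_trans ad; rewrite dab dba.
- by move: ev; rewrite dab dba /= negbK.
Qed.

(** Rounding every entry 1 of m to 0 or 2, in the two possible ways c and c',
    gives vertices with W_m^2 = W_c W_c'. *)
Lemma vertex_nonzero (K : fieldType) (W : 'M[nat]_(3, 2) -> K) :
  (forall m m' n n', even_exponent m -> even_exponent m' -> even_exponent n ->
     even_exponent n' -> balanced m m' n n' -> W m * W m' = W n * W n') ->
  forall m, even_exponent m -> W m != 0 ->
  exists c, W (chart_exponent c 0%MM) != 0.
Proof.
move=> hW m em Wm.
pose c i : 'I_2 := if (0 < m i 0%R)%N then 0 else 1.
pose c' i : 'I_2 := if m i 0 == 2%N then 0 else 1.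
have e0 d : even_exponent (chart_exponent d 0%MM).
  by apply: even_chart_exponent => [i|]; rewrite ?mnm0E // mdeg0.
exists c; apply: contraNneq Wm => Wc.
rewrite -sqrf_eq0 expr2 (hW _ _ (chart_exponent c 0%MM) (chart_exponent c' 0%MM)) //.
  by rewrite Wc mul0r.
move=> i j; rewrite !mxE !mnm0E /c /c'; have := em.1 i; elim/ord2P: j => /=.
  by case: (m i 0) => [|[|[|?]]] /=; lia.
by case: (m i 0) => [|[|[|?]]] /=; lia.
Qed.

(** The values W of the invariant monomials are subject only to the binomial
    relations between products of two of them. *)
Lemma monomial_point (K : numClosedFieldType) (W : 'M[nat]_(3, 2) -> K) :
  (forall m m' n n', even_exponent m -> even_exponent m' -> even_exponent n ->
     even_exponent n' -> balanced m m' n n' -> W m * W m' = W n * W n') ->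
  forall m0, even_exponent m0 -> W m0 != 0 ->
  exists (x : 'M[K]_(3, 2)) (u : K),
    [/\ forall i, row i x != 0, u != 0
      & forall m, even_exponent m -> W m = u * coord_monomial m x].
Proof.
move=> hW m0 em0 Wm0; have [c Wc] := vertex_nonzero hW em0 Wm0.
pose D (a : 'X_{1..3}) := [forall i, a i <= 2]%N && ~~ odd (mdeg a).
pose U a := W (chart_exponent c a).
have eD a : D a -> even_exponent (chart_exponent c a).
  by move=> /andP[/forallP a2 ev]; apply: even_chart_exponent.
have UE a a' b b' : D a -> D a' -> D b -> D b' -> (a + a' = b + b')%MM ->
    U a * U a' = U b * U b'.
  move=> Da Da' Db Db' E; apply: hW; try exact: eD.
  move=> i j.
  have := congr1 (fun m : 'X_{1..3} => m i) E; rewrite !mnmDE !mxE.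
  move: Da Da' Db Db' => /andP[/forallP/(_ i) ? _] /andP[/forallP/(_ i) ? _].
  by move=> /andP[/forallP/(_ i) ? _] /andP[/forallP/(_ i) ? _]; case: eqP; lia.
have D0 : D 0%MM by apply/andP; split; [apply/forallP=> i; rewrite mnm0E|rewrite mdeg0].
have D2 i j : D (U_(i) + U_(j))%MM.
  apply/andP; split; last by rewrite mdegD !mdeg1.
  by apply/forallP=> k; rewrite mnmDE !mnm1E; do 2!case: eqP.
(* The candidate values of the products t_i t_j in the chart at the vertex c. *)
pose A i j := U (U_(i) + U_(j))%MM / U 0%MM.
have [i j k l|t At] := @rank_one_symmetric _ _ A.
  rewrite /A !mulrA; congr (_ / _); rewrite ![_ / _ * _]mulrAC; congr (_ / _).
  by apply: UE => //; apply/mnmP => s; rewrite !mnmDE; lia.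
exists (chart_point c t), (U 0%MM); split=> // [i|m em].
  apply/eqP => /rowP /(_ (c i)); rewrite !mxE eqxx => /eqP.
  by rewrite oner_eq0.
have [a [a2 ev ->]] := chart_exponent_exists c em.
rewrite coord_monomial_chart -/(U a); apply: (monomial_of_quadrics (D := D)) => //.
- move=> b i j Db; have Db' : D b.
    move: Db => /andP[/forallP b2]; rewrite !mdegD !mdeg1 !addn1 /= negbK => bev.
    rewrite /D bev andbT; apply/forallP => k; apply: leq_trans (b2 k).
    by rewrite !mnmDE -addnA leq_addr.
  split=> //; apply: UE => //; apply/mnmP => s; rewrite !mnmDE mnm0E; lia.
- by move=> i j; rewrite -At mulrC divfK.
- by apply/andP; split=> //; apply/forallP.
Qed.

(** * Equations of the quotient *)

Definition binomial_quadrics (K : fieldType) (e : 'I_14 -> 'M[nat]_(3, 2)) :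
    set {mpoly K[14]} :=
  [set F | exists k k' l l', balanced (e k) (e k') (e l) (e l') /\
     F = 'X_k * 'X_k' - 'X_l * 'X_l'].

Lemma binomial_quadrics_homog (K : fieldType) e F :
  @binomial_quadrics K e F -> F \is 2.-homog.
Proof.
have X2 k l : ('X_k * 'X_l : {mpoly K[14]}) \is 2.-homog.
  by rewrite -mpolyXD dhomogX; apply/eqP; rewrite /= mdegD !mdeg1.
move=> [k [k' [l [l' [_ ->]]]]]; apply: rpredB; exact: X2.
Qed.

Lemma even_exponent_enum (K : numFieldType) e :
  enum_invariants K e -> forall m, even_exponent m <-> exists k, e k = m.
Proof. by move=> [_ eP] m; rewrite -(invariant_exponentP K) eP. Qed.

(** For the inclusion of the zero locus, the coordinates of a point are read as
    the values of the invariant monomials and [monomial_point] produces the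
    preimage. *)
Lemma W_BS13_quadrics (K : numClosedFieldType) e :
  enum_invariants K e -> W_BS13 K e = zero_locus (@binomial_quadrics K e).
Proof.
move=> eK; have eP := even_exponent_enum eK; have [ei _] := eK.
have hom F : @binomial_quadrics K e F -> exists d : nat, F \is d.-homog.
  by move=> /binomial_quadrics_homog; exists 2%N.
apply/seteqP; split=> q.
  move=> [p [x [px qx]]]; apply: (mem_zero_locus hom qx) => F.
  move=> [k [k' [l [l' [bal ->]]]]].
  rewrite mevalB !mevalM !mevalXU !mxE; apply/eqP; rewrite subr_eq0.
  by rewrite (coord_monomial_balanced x bal).
move=> qz.
have : val q != 0%VS by rewrite -dimv_eq0 (eqP (valP q)).
rewrite -vpick0; set v := vpick _ => v0.
have qv : hcoord q v by rewrite /hcoord v0 memv_pick.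
pose W m := \sum_(k < 14 | e k == m) v 0 k.
have We k : W (e k) = v 0 k.
  by rewrite /W (big_pred1 k) // => l; rewrite /= (inj_eq ei).
have [k vk] : exists k, v 0 k != 0.
  apply/existsP; apply: contraNT v0; rewrite negb_exists => /forallP v0.
  by apply/eqP/rowP => k; rewrite mxE; apply/eqP; have := v0 k; rewrite negbK.
have ek : even_exponent (e k) by apply/eP; exists k.
have hW m m' n n' : even_exponent m -> even_exponent m' -> even_exponent n ->
    even_exponent n' -> balanced m m' n n' -> W m * W m' = W n * W n'.
  move=> /eP[i <-] /eP[i' <-] /eP[l <-] /eP[l' <-] bal; rewrite !We.
  have := qz ('X_i * 'X_i' - 'X_l * 'X_l') v.
  rewrite mevalB !mevalM !mevalXU => E; apply/eqP; rewrite -subr_eq0; apply/eqP.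
  by apply: E => //; exists i, i', l, l'.
have Wk : W (e k) != 0 by rewrite We.
have [x [u [x0 u0 Wx]]] := monomial_point hW ek Wk.
have [p px] := fin_all_exists (fun i => hcoord_exists (x0 i)).
exists p, x; split=> //; rewrite (_ : \row_l _ = u^-1 *: v).
  by apply: hcoordZ; rewrite ?invr_eq0.
apply/rowP => l; rewrite !mxE -We Wx ?mulKf //; apply/eP; by exists l.
Qed.

(** * Density of the open torus *)

Lemma poly_eq0_of_horner (K : numFieldType) (p : {poly K}) :
  (forall t, p.[t] = 0) -> p = 0.
Proof.
move=> p0; apply/eqP; apply: contraT => pn0.
have := @max_poly_roots _ p [seq i%:R | i <- iota 0 (size p)] pn0.
rewrite size_map size_iota ltnn; apply.
  by apply/allP => t _; apply/rootP/p0.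
rewrite map_inj_uniq ?iota_uniq // => i j /eqP; rewrite eqr_nat; exact: eqP.
Qed.

(** Restrict F to the line through x with direction (1, ..., 1), which meets the
    coordinate hyperplanes in at most six points: the restriction is a polynomial
    in one variable with infinitely many zeros. *)
Lemma form_zero_from_torus (K : numFieldType) n (F : {mpoly K[n]})
    (e : 'I_n -> 'M[nat]_(3, 2)) :
  (forall y : 'M[K]_(3, 2), (forall i j, y i j != 0) ->
     F.@[fun k => coord_monomial (e k) y] = 0) ->
  forall x : 'M[K]_(3, 2), F.@[fun k => coord_monomial (e k) x] = 0.
Proof.
move=> F0 x; pose L i j : {poly K} := (x i j)%:P + 'X.
pose G : {poly K} := \sum_(m <- msupp F)
  (F@_m)%:P * \prod_k (\prod_(i < 3) \prod_(j < 2) L i j ^+ e k i j) ^+ m k.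
have GE t : G.[t] = F.@[fun k => coord_monomial (e k) (x + const_mx t)].
  rewrite mevalE horner_sum; apply: eq_bigr => m _; rewrite hornerM hornerC.
  congr (_ * _); rewrite horner_prod; apply: eq_bigr => k _; rewrite horner_exp.
  congr (_ ^+ _); rewrite horner_prod; apply: eq_bigr => i _.
  rewrite horner_prod; apply: eq_bigr => j _.
  by rewrite horner_exp hornerD hornerC hornerX !mxE.
suff G0 : G = 0.
  have := GE 0; rewrite G0 horner0 => ->; apply: meval_eq => k.
  by congr coord_monomial; apply/matrixP => i j; rewrite !mxE addr0.
pose N := \prod_(i < 3) \prod_(j < 2) L i j.
have N0 : N != 0.
  apply/prodf_neq0 => i _; apply/prodf_neq0 => j _.
  by rewrite -size_poly_eq0 /L addrC size_XaddC.
(* N vanishes exactly at the parameters of the excluded points. *)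
apply: (mulIf N0); rewrite mul0r; apply: poly_eq0_of_horner => t.
rewrite hornerM; have [->|Nt] := eqVneq N.[t] 0; first by rewrite mulr0.
rewrite GE F0 ?mul0r // => i j; move: Nt; rewrite horner_prod.
move=> /prodf_neq0/(_ i isT); rewrite horner_prod => /prodf_neq0/(_ j isT).
by rewrite hornerD hornerC hornerX !mxE.
Qed.

(** * Multiplicity along the edges *)

Lemma mderivm_homog (R : comNzRingType) n d (F : {mpoly R[n]}) m :
  F \is d.-homog -> F^`M[m] \is (d - mdeg m).-homog.
Proof.
move=> /dhomogP hF; apply/dhomogP => m'.
rewrite mcoeff_msupp mcoeff_mderivm => cm /=.
have /hF /= <- : (m + m')%MM \in msupp F.
  by rewrite mcoeff_msupp; apply: contraNneq cm => ->; rewrite mul0rn.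
by rewrite mdegD addKn.
Qed.

(** On the line joining the coordinate points i and j, with x_i = 1 and x_j = t,
    G is a polynomial in t; as G is homogeneous, distinct monomials in x_i and
    x_j give distinct powers of t. *)
Lemma coef_on_line (K : numFieldType) n d (G : {mpoly K[n]}) (i j : 'I_n) :
  i != j -> G \is d.-homog ->
  (forall v : 'I_n -> K, v i != 0 -> (forall s, s != i -> s != j -> v s = 0) ->
     G.@[v] = 0) ->
  forall m : 'X_{1..n}, (forall s, s != i -> s != j -> m s = 0%N) -> G@_m = 0.
Proof.
move=> ij /dhomogP hG G0 m m0; apply/eqP; rewrite mcoeff_eq0; apply/negP => mG.
pose on (m : 'X_{1..n}) := [forall s, (s != i) ==> (s != j) ==> (m s == 0%N)].
have onm : on m by apply/forallP => s; apply/implyP=> ?; apply/implyP=> ?; apply/eqP/m0.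
pose P : {poly K} := \sum_(m <- msupp G | on m) G@_m *: 'X^(m j).
have P0 : P = 0.
  apply: poly_eq0_of_horner => t.
  pose v s : K := if s == i then 1 else if s == j then t else 0.
  rewrite -(G0 v); first last.
  - by move=> s si sj; rewrite /v (negbTE si) (negbTE sj).
  - by rewrite /v eqxx oner_eq0.
  rewrite mevalE horner_sum [RHS](bigID on) /= [X in _ + X]big1 ?addr0.
    apply: eq_bigr => b /forallP onb; rewrite hornerZ hornerXn; congr (_ * _).
    rewrite (bigD1 j) //= {1}/v eq_sym (negbTE ij) eqxx big1 ?mulr1 // => s sj.
    have := onb s; rewrite sj /v (negbTE sj); case: ifP => [_|_] /=.
      by rewrite expr1n.
    by move=> /eqP ->.
  move=> b; rewrite negb_forall => /existsP[s]; rewrite !negb_imply.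
  move=> /and3P[si sj bs]; rewrite (bigD1 s) //= {1}/v (negbTE si) (negbTE sj).
  by rewrite expr0n (negbTE bs) mul0r mulr0.
have degE (b : 'X_{1..n}) : on b -> mdeg b = (b i + b j)%N.
  move=> /forallP onb; rewrite mdegE (bigD1 i) //= (bigD1 j) 1?eq_sym //=.
  rewrite big1 ?addn0 // => s /andP[si sj]; apply/eqP.
  by have := onb s; rewrite si sj.
move/polyP: P0 => /(_ (m j)); rewrite coef0 /P coef_sum.
rewrite big_mkcond (bigD1_seq m) ?msupp_uniq //= onm coefZ coefXn eqxx mulr1 big1_seq.
  by rewrite addr0 => /eqP; rewrite mcoeff_eq0 mG.
move=> b /andP[bm bG]; case: ifP => // onb; rewrite coefZ coefXn.
case: eqP => [mb|]; last by rewrite mulr0.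
case/eqP: bm; apply/mnmP => s.
have [->|sj] := eqVneq s j; first by [].
have [->|si] := eqVneq s i.
  have := degE _ onb; have := degE _ onm.
  by rewrite (hG _ bG : mdeg b = d) (hG _ mG : mdeg m = d) mb => -> /addIn.
rewrite m0 //; apply/eqP; by move/forallP: onb => /(_ s); rewrite si sj.
Qed.

(** For distinct i and j, the order of vanishing of the monomial m along the line
    joining the coordinate points i and j. *)
Definition off_degree n (i j : 'I_n) (m : 'X_{1..n}) :=
  (\sum_(s | (s != i) && (s != j)) m s)%N.

Lemma edge1P (K : fieldType) (i j : 'I_4) (p : proj K 3) v :
  i != j -> hcoord p v ->
  edge 1%:M i j p <-> (forall s, s != i -> s != j -> v 0 s = 0).
Proof.
move=> ij pv; have [v0 vp] := andP pv.
have -> : edge 1%:M i j p <-> v \in (<[row i 1%:M]> + <[row j 1%:M]>)%VS.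
  rewrite /edge /=; split=> [/subvP /(_ v vp)//|vij].
  apply/subvP => w wp; have [->|w0] := eqVneq w 0; first exact: mem0v.
  have [|a _ ->] := hcoord_scale pv (w := w); first by rewrite /hcoord w0.
  by rewrite memvZ.
split=> [/memv_addP[a /vlineP[x ->] [b /vlineP[y ->] ->]] s si sj|vs].
  rewrite !mxE [i == s]eq_sym [j == s]eq_sym (negbTE si) (negbTE sj).
  by rewrite !mulr0 addr0.
apply/memv_addP; exists (v 0 i *: row i 1%:M); first by rewrite memvZ ?memv_line.
exists (v 0 j *: row j 1%:M); first by rewrite memvZ ?memv_line.
apply/rowP => s; rewrite !mxE [i == s]eq_sym [j == s]eq_sym.
have [->|si] := eqVneq s i; first by rewrite (negbTE ij) mulr1 mulr0 addr0.
have [->|sj] := eqVneq s j; first by rewrite mulr1 mulr0 add0r.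
by rewrite !mulr0 addr0 vs.
Qed.

(** A monomial m of F of order less than k along the edge is detected by
    differentiating F along the part mu of m transverse to the edge: on the edge
    this leaves a nonzero multiple of the remaining part of m. *)
Lemma mult_ge_edge1P (K : numFieldType) d k (F : {mpoly K[4]}) (i j : 'I_4) :
  i != j -> F \is d.-homog ->
  (forall p, edge 1%:M i j p -> mult_ge k F p) <->
  {in msupp F, forall m, k <= off_degree i j m}%N.
Proof.
move=> ij hF; split=> [mF m mS|Fk p ep v m pv mk].
  rewrite leqNgt; apply/negP => lt_k.
  pose mu : 'X_{1..4} := [multinom (if (s != i) && (s != j) then m s else 0)%N | s < 4].
  have dmu : mdeg mu = off_degree i j m.
    by rewrite mdegE /off_degree [RHS]big_mkcond; apply: eq_bigr => s _; rewrite mnmE.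
  have mu_le : (mu <= m)%MM by apply/mnm_lepP => s; rewrite mnmE; case: ifP.
  have onE s : s != i -> s != j -> (m - mu)%MM s = 0%N.
    by move=> si sj; rewrite mnmBE mnmE si sj subnn.
  have vanish (v : 'I_4 -> K) : v i != 0 ->
      (forall s, s != i -> s != j -> v s = 0) -> (F^`M[mu]).@[v] = 0.
    move=> vi vs; pose w : 'rV[K]_4 := \row_s v s.
    have w0 : w != 0 by apply: contraNneq vi => /rowP/(_ i); rewrite !mxE => ->.
    have [p pw] := hcoord_exists w0.
    rewrite -(meval_eq _ (v1 := w 0)); last by move=> s; rewrite mxE.
    apply: (mF p) => //; last by rewrite dmu.
    by apply/(edge1P ij pw) => s si sj; rewrite mxE vs.
  have /eqP := coef_on_line ij (mderivm_homog mu hF) vanish onE.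
  rewrite mcoeff_mderivm addmC submK // mulrn_eq0 mcoeff_eq0 mS orbF.
  apply/negP; rewrite -lt0n; apply: prodn_gt0 => s.
  by rewrite ffact_gt0; have /mnm_lepP := mu_le.
rewrite mevalE big_seq big1 // => b.
rewrite mcoeff_msupp mcoeff_mderivm => cb.
have /Fk bk : (m + b)%MM \in msupp F.
  by rewrite mcoeff_msupp; apply: contraNneq cb => ->; rewrite mul0rn.
have : (0 < off_degree i j b)%N.
  have : (off_degree i j m <= mdeg m)%N.
    by rewrite mdegE [X in (_ <= X)%N](bigID (fun s => (s != i) && (s != j))) leq_addr.
  move: bk; rewrite /off_degree.
  under eq_bigr do rewrite mnmDE.
  by rewrite big_split /=; lia.
rewrite lt0n sum_nat_eq0 negb_forall => /existsP[s].
rewrite negb_imply => /andP[/andP[si sj] bs].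
have v0 := (edge1P ij pv).1 ep s si sj.
by rewrite [X in _ * X](bigD1 s) //= v0 expr0n (negbTE bs) mul0r mulr0.
Qed.

(** * Exponents of the sextics *)

(** The i-th coordinate of the t-th vertex of the tetrahedron 111, 100, 010, 001
    inscribed in the unit cube; equivalently the face of direction i through
    that vertex. *)
Definition face (t : 'I_4) (i : 'I_3) : 'I_2 :=
  if (val t == 0%N) || (val t == i.+1) then 1 else 0.

(** The linear map inverting, up to the shift by 2, the sum over the faces. The
    halves are exact on [even_exponent]: see [sextic_exponent_double]. *)
Definition sextic_exponent (m : 'M[nat]_(3, 2)) : 'X_{1..4} :=
  [multinom (\sum_i m i (face t i))./2 | t < 4].

Lemma ord3P (P : 'I_3 -> Prop) :
  P ord0 -> P (lift ord0 ord0) -> P (lift ord0 (lift ord0 ord0)) -> forall i, P i.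
Proof.
move=> P0 P1 P2 i.
by do 3!(case: (unliftP ord0 i) => [{}i ->|->] //); case: i.
Qed.

Lemma ord4P (P : 'I_4 -> Prop) :
  P ord0 -> P (lift ord0 ord0) -> P (lift ord0 (lift ord0 ord0)) ->
  P (lift ord0 (lift ord0 (lift ord0 ord0))) -> forall t, P t.
Proof.
move=> P0 P1 P2 P3 t.
by do 4!(case: (unliftP ord0 t) => [{}t ->|->] //); case: t.
Qed.

(* For goals linear in the entries of m, taken as independent unknowns. *)
Ltac lia_entries m :=
  repeat match goal with |- context [fun_of_matrix m ?i ?j] =>
    move: (fun_of_matrix m i j) => ? end; lia.

(** The parity of the exponents in a row is the same in both columns, since the
    row sums to 2; so choosing one entry in each row gives a sum of the parity of
    the second column. *)
Lemma sextic_exponent_double m t : even_exponent m ->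
  (sextic_exponent m t).*2 = (\sum_i m i (face t i))%N.
Proof.
move=> [dm ev]; rewrite mnmE halfK (_ : odd _ = false) ?subn0 //.
apply/negbTE; move: ev; rewrite !odd_sum; congr (~~ _); apply: eq_bigr => i _.
by have := dm i; elim/ord2P: (face t i) => ?; lia.
Qed.

(** The face (i, j) has two vertices t. Their sums of entries contribute m_ij
    twice and each of the other two rows once, that is 2 m_ij + 4. *)
Lemma sum_sextic_exponent m i j : even_exponent m ->
  (\sum_(t | face t i == j) sextic_exponent m t = m i j + 2)%N.
Proof.
move=> em; have [dm _] := em; rewrite big_mkcond.
have := fun t => sextic_exponent_double t em; move: (sextic_exponent m) => b db.
have := db ord0; have := db (lift ord0 ord0).
have := db (lift ord0 (lift ord0 ord0)).
have := db (lift ord0 (lift ord0 (lift ord0 ord0))).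
have := dm ord0; have := dm (lift ord0 ord0).
have := dm (lift ord0 (lift ord0 ord0)).
rewrite !big_ord_recl !big_ord0 /face /=.
by elim/ord2P: j; elim/ord3P: i => /=; lia_entries m.
Qed.

(** The exponents of the sextic monomials double along the six edges. *)
Definition double_exponent (b : 'X_{1..4}) :=
  mdeg b = 6%N /\ forall i j : 'I_4, i != j -> (2 <= off_degree i j b)%N.

Lemma sextic_exponent_inj m m' : even_exponent m -> even_exponent m' ->
  sextic_exponent m = sextic_exponent m' -> m = m'.
Proof.
move=> em em' E; apply/matrixP => i j; apply: (@addIn 2).
by rewrite -!sum_sextic_exponent // E.
Qed.

Lemma double_sextic_exponent m :
  even_exponent m -> double_exponent (sextic_exponent m).
Proof.
move=> em; have s i j := sum_sextic_exponent i j em.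
split=> [|i j].
  rewrite mdegE (partition_big (face^~ ord0) predT) //= big_ord2 !s /=.
  by have := em.1 ord0; lia.
rewrite /off_degree [in (2 <= _)%N]big_mkcond.
have := s ord0 0; have := s ord0 1.
have := s (lift ord0 ord0) 0; have := s (lift ord0 ord0) 1.
have := s (lift ord0 (lift ord0 ord0)) 0.
have := s (lift ord0 (lift ord0 ord0)) 1.
rewrite !(big_mkcond (fun t => face t _ == _)) !big_ord_recl !big_ord0 /face /=.
by elim/ord4P: i; elim/ord4P: j => /=; lia_entries m.
Qed.

(** The preimage is forced by [sum_sextic_exponent]. Each face of the cube contains
    one edge of the tetrahedron, and the condition on b along the opposite edge
    makes the corresponding entry nonnegative. *)
Lemma sextic_exponent_surj b : double_exponent b ->
  exists2 m, even_exponent m & sextic_exponent m = b.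
Proof.
move=> [db off]; pose m : 'M[nat]_(3, 2) :=
  \matrix_(i, j) (\sum_(t | face t i == j) b t - 2)%N.
have mE i j : (\sum_(t | face t i == j) b t = m i j + 2)%N.
  rewrite mxE subnK //.
  have := off ord0 (lift ord0 ord0) isT.
  have := off ord0 (lift ord0 (lift ord0 ord0)) isT.
  have := off ord0 (lift ord0 (lift ord0 (lift ord0 ord0))) isT.
  have := off (lift ord0 ord0) (lift ord0 (lift ord0 ord0)) isT.
  have := off (lift ord0 ord0) (lift ord0 (lift ord0 (lift ord0 ord0))) isT.
  have := off (lift ord0 (lift ord0 ord0)) (lift ord0 (lift ord0 (lift ord0 ord0))) isT.
  rewrite /off_degree !(big_mkcond (fun t => (t != _) && _)).
  rewrite (big_mkcond (fun t => face t _ == _)).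
  rewrite !big_ord_recl !big_ord0 /face /=.
  by elim/ord2P: j; elim/ord3P: i => /=; lia.
have dm i : (m i 0%R + m i 1%R = 2)%N.
  have : (m i 0%R + 2 + (m i 1%R + 2) = 6)%N.
    rewrite -!mE -db mdegE.
    by rewrite [RHS](partition_big (face^~ i) predT) //= big_ord2.
  by lia.
have tot t : (\sum_i m i (face t i) = (b t).*2)%N.
  have := db; rewrite mdegE.
  have := fun i => mE i (face t i).
  move=> E; have := E ord0; have := E (lift ord0 ord0).
  have := E (lift ord0 (lift ord0 ord0)).
  rewrite !(big_mkcond (fun t => face t _ == _)) !big_ord_recl !big_ord0 /face /=.
  by elim/ord4P: t {E} => /=; lia_entries m.
exists m; last by apply/mnmP => t; rewrite mnmE tot doubleK.
by split=> //; rewrite -[\sum_i _]/(\sum_i m i (face ord0 i))%N tot odd_double.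
Qed.

Lemma sextics_double_exponent (K : numFieldType) (F : {mpoly K[4]}) :
  double_edge_sextics 1%:M F <-> {in msupp F, forall b, double_exponent b}.
Proof.
split=> [[hF mF] b bF|Fb].
  split=> [|i j]; first by move/dhomogP: hF => /(_ b bF).
  wlog ij : i j / (i < j)%N => [th ne|ne].
    case: (ltngtP i j) => [|ji|/val_inj E]; first by move/th; apply.
      have := th j i ji; rewrite eq_sym => /(_ ne).
      by rewrite /off_degree; under eq_bigl do rewrite andbC.
    by rewrite E eqxx in ne.
  by apply: (mult_ge_edge1P 2 ne hF).1 => // p; apply: mF.
have hF : F \is 6.-homog by apply/dhomogP => b /Fb [].
split=> // i j p ij; have ne : i != j by apply: contraTneq ij => ->; rewrite ltnn.
by apply: (mult_ge_edge1P 2 ne hF).2 => b /Fb [_]; apply.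
Qed.

Lemma sextic_monomials_basis (K : numFieldType) e : enum_invariants K e ->
  basis_of_system (double_edge_sextics 1%:M)
    (fun k => 'X_[sextic_exponent (e k)] : {mpoly K[4]}).
Proof.
move=> eK; have eP := even_exponent_enum eK; have [ei _] := eK.
have ee k : even_exponent (e k) by apply/eP; exists k.
split=> [k|F /sextics_double_exponent FL].
  apply/sextics_double_exponent => b; rewrite msuppX inE => /eqP ->.
  exact: double_sextic_exponent.
have coefE (c : 'rV[K]_14) l :
    (\sum_(k < 14) c 0 k *: 'X_[sextic_exponent (e k)])@_(sextic_exponent (e l))
      = c 0 l.
  rewrite raddf_sum (bigD1 l) //= mcoeffZ mcoeffX eqxx mulr1 big1 ?addr0 // => k kl.
  rewrite /= mcoeffZ mcoeffX; case: eqP => [/sextic_exponent_inj E|].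
    by rewrite (ei _ _ (E (ee k) (ee l))) eqxx in kl.
  by rewrite mulr0.
exists (\row_k F@_(sextic_exponent (e k))); split=> [|c ->].
  apply/mpolyP => b; have [bF|] := boolP (b \in msupp F).
    have [m em <-] := sextic_exponent_surj (FL b bF).
    by have [l <-] := (eP m).1 em; rewrite coefE mxE.
  move=> bF; rewrite raddf_sum big1 ?memN_msupp_eq0 // => k _.
  rewrite /= mcoeffZ mcoeffX mxE; case: eqP => [->|]; last by rewrite mulr0.
  by rewrite memN_msupp_eq0 ?mul0r.
by apply/rowP => l; rewrite mxE coefE.
Qed.

(** * The map from the cube to P^3 *)

(** The rational map from the cube of P^1 to P^3 identifying the two threefolds
    birationally after passing to the quotient. *)
Definition cube_to_P3 (K : fieldType) (x : 'M[K]_(3, 2)) : 'rV[K]_4 :=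
  \row_t \prod_i x i (face t i).

(** The square of the product of the coordinates accounts for the shift by 2 in
    [sum_sextic_exponent]. *)
Lemma sextic_monomial_cube (K : fieldType) m (x : 'M[K]_(3, 2)) :
  even_exponent m ->
  'X_[sextic_exponent m].@[cube_to_P3 x 0] =
    (\prod_i \prod_j x i j) ^+ 2 * coord_monomial m x.
Proof.
move=> em; rewrite mevalX.
under [LHS]eq_bigr do rewrite mxE -prodrXl.
rewrite exchange_big -prodrXl -big_split; apply: eq_bigr => i _ /=.
rewrite (partition_big (face^~ i) predT) //= -prodrXl -big_split.
apply: eq_bigr => j _; rewrite /= -exprD addnC -sum_sextic_exponent //.
by rewrite expr_sum; apply: eq_bigr => t /eqP ->.
Qed.

(** A product of two sextic monomials is determined by the sum of the exponents m,
    because [sextic_exponent] is additive; so the binomial quadrics vanish on the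
    whole image. *)
Lemma ratmap_sub_W_BS13 (K : numClosedFieldType) e : enum_invariants K e ->
  ratmap_image (fun k => 'X_[sextic_exponent (e k)] : {mpoly K[4]})
    `<=` W_BS13 K e.
Proof.
move=> eK; have eP := even_exponent_enum eK.
have ee k : even_exponent (e k) by apply/eP; exists k.
rewrite W_BS13_quadrics // => q [p [v [_ qv]]].
apply: (mem_zero_locus _ qv) => [F /binomial_quadrics_homog|F]; first by exists 2%N.
move=> [k [k' [l [l' [bal ->]]]]]; rewrite mevalB !mevalM !mevalXU !mxE -!mevalM.
rewrite -!mpolyXD; apply/eqP; rewrite subr_eq0; apply/eqP; do 2!f_equal.
apply/mnmP => t; rewrite !mnmDE; apply: double_inj.
rewrite !doubleD !sextic_exponent_double // -!big_split.
by apply: eq_bigr => i _; exact: bal.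
Qed.

(** Where all coordinates of y are nonzero, the invariant monomials at y are
    proportional to the sextics at the image of y in P^3; the rest of the
    quotient is reached by [form_zero_from_torus]. *)
Lemma W_BS13_sub_closed (K : numClosedFieldType) e Z : enum_invariants K e ->
  zariski_closed Z ->
  ratmap_image (fun k => 'X_[sextic_exponent (e k)] : {mpoly K[4]}) `<=` Z ->
  W_BS13 K e `<=` Z.
Proof.
move=> eK [S [hS ->]] imZ q [p [x [_ qx]]].
have eP := even_exponent_enum eK.
have ee k : even_exponent (e k) by apply/eP; exists k.
apply: (mem_zero_locus hS qx) => F SF.
rewrite (meval_eq _ (v2 := fun k => coord_monomial (e k) x)); last first.
  by move=> k; rewrite mxE.
move: x {p qx} => x; apply: form_zero_from_torus x => y y0.
set M := (\prod_i \prod_j y i j) ^+ 2.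
have M0 : M != 0.
  by rewrite expf_neq0 //; apply/prodf_neq0 => i _; apply/prodf_neq0 => j _.
have yP : cube_to_P3 y != 0.
  apply/eqP => /rowP/(_ 0) /eqP; rewrite !mxE; apply/negP.
  by apply/prodf_neq0 => i _.
pose w : 'rV[K]_14 := \row_k 'X_[sextic_exponent (e k)].@[cube_to_P3 y 0].
have wE k : w 0 k = M * coord_monomial (e k) y by rewrite mxE sextic_monomial_cube.
have wn0 : w != 0.
  apply/eqP => /rowP/(_ 0) /eqP; rewrite wE mxE mulf_eq0 (negbTE M0); apply/negP.
  by apply/prodf_neq0 => i _; apply/prodf_neq0 => j _; rewrite expf_neq0.
have [p py] := hcoord_exists yP; have [r rw] := hcoord_exists wn0.
have [d hF] := hS F SF.
have : F.@[w 0] = 0 by apply: (imZ r) => //; exists p, (cube_to_P3 y).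
rewrite (meval_eq _ (v2 := fun k => M * coord_monomial (e k) y)) //.
rewrite (dhomog_mevalZ _ _ hF) => /eqP.
rewrite mulf_eq0 expf_eq0 (negbTE M0) andbF; exact: eqP.
Qed.

Lemma W_BS13_is_FEF13 (K : numClosedFieldType) e :
  enum_invariants K e -> is_FEF13 (W_BS13 K e).
Proof.
move=> eK; exists 1%:M, (fun k => 'X_[sextic_exponent (e k)]); split.
- exact: unitmx1.
- exact: sextic_monomials_basis.
- apply/seteqP; split=> [q Wq Z [cZ imZ]|]; first exact: (W_BS13_sub_closed eK cZ imZ).
  apply: smallest_sub; last exact: ratmap_sub_W_BS13.
  rewrite W_BS13_quadrics //; exists (@binomial_quadrics K e); split=> // F.
  by move=> /binomial_quadrics_homog; exists 2%N.
Qed.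

Theorem theorem1p3 (R : realType) (e : 'I_14 -> 'M[nat]_(3, 2))
  (e_enum : enum_invariants R[i]%C e) : is_FEF13 (W_BS13 R[i]%C e).
Proof. exact: (W_BS13_is_FEF13 e_enum). Qed.
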